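(* Let $G$ be a Hausdorff left-topological group, let $\mathscr{M}_a=(G,M_a)$ be the canonical a.a. flow of $G$, let $\mathscr{M}_{eq}$ be the universal minimal equicontinuous compact flow of $G$, and let $A=\mathrm{A}(\mathscr{M}_a)$ be the set of a.a. points of $\mathscr{M}_a$. Let $\boldsymbol{z}\in M_a^{A}$ be defined by $\boldsymbol{z}(a)=a$ for all $a\in A$, let $Z=\overline{G\boldsymbol{z}}\subseteq M_a^A$, and let $\mathscr{Z}=(G,Z)$ with the coordinatewise action. Then: (1) $\mathscr{M}_a$ is a universal a.a. flow of $G$. (2) A compact flow $\mathscr{Y}$ of $G$ is a universal a.a. flow of $G$ if and only if it is a maximal almost 1-1 extension of $\mathscr{M}_{eq}$. (3) If $\phi$ is an endomorphism of $\mathscr{M}_a$ such that $a\in\eta(\phi(a))[A]$ for some $a\in A$ and some homomorphism $\eta:\mathscr{M}_a\to\mathscr{Z}$, then $\phi$ is an automorphism of $\mathscr{M}_a$. (Here $\eta(\phi(a))\in Z\subseteq M_a^A$ is regarded as a map $A\to M_a$, and $\eta(\phi(a))[A]$ is its image.) In particular, the universal a.a. flow of $G$ is unique up to almost 1-1 extensions: for any two universal a.a. flows $\mathscr{X}_1,\mathscr{X}_2$ of $G$ there is an almost 1-1 extension $\mathscr{X}_1\to\mathscr{X}_2$.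
   Context: A Hausdorff left-topological group is a group $G$ with a Hausdorff topology for which every left translation $x\mapsto yx$ is continuous; $e$ is its identity. For $f:G\to\mathbb{C}$ and $t\in G$ let $(ft)(x)=f(tx)$ and $(tf)(x)=f(xt)$. $\mathrm{LUC}(G)$ is the set of bounded continuous $f:G\to\mathbb{C}$ such that $ft_n\to ft$ uniformly on $G$ whenever $t_n\to t$ in $G$. A function $f:G\to\mathbb{C}$ is left almost automorphic, $f\in \mathrm{A}_{c,L}(G)$, if every net $\{t_n\}$ in $G$ has a subnet $\{t_{n'}\}$ and there is some continuous $\phi:G\to\mathbb{C}$ with $t_{n'}f\to\phi$ and $t_{n'}^{-1}\phi\to f$ pointwise on $G$. The space $M_a$: put $\mathbb{V}=\mathrm{A}_{c,L}(G)\cap\mathrm{LUC}(G)$ (a norm closed, self-adjoint, right-invariant subalgebra of the bounded continuous functions containing the constants, where right-invariant means $ft\in\mathbb V$ for $f\in\mathbb V$, $t\in G$). For $t\in G$ let $t^*\in\mathbb{V}^*$ be $f\mapsto f(t)$. $M_a$ is the weak-$*$ closure of $\{t^*:t\in G\}$ in $\mathbb{V}^*$, with the action $(t\mu)(f)=\mu(ft)$. This is a compact flow, denoted $\mathscr{M}_a$ and called the canonical a.a. flow of $G$. A compact flow is a jointly continuous action of $G$ on a compact Hausdorff space. A homomorphism is a continuous $G$-equivariant map; a surjective homomorphism $\mathscr{X}\to\mathscr{Y}$ is called an extension, and then $\mathscr{Y}$ is a factor of $\mathscr{X}$. An endomorphism is a homomorphism of a flow to itself; an automorphism is a bijective one (a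 homeomorphism). An extension $\phi:X\to Y$ of minimal flows is almost 1-1 if there is $x\in X$ with $\phi^{-1}(\phi(x))=\{x\}$. A point $x$ of a compact flow $\mathscr{X}$ is a.a., $x\in\mathrm{A}(\mathscr{X})$, if for every net $\{t_n\}$ in $G$, $t_nx\to y$ implies $t_n^{-1}y\to x$. A compact flow is an a.a. flow if it has an a.a. point with dense orbit. An a.a. flow is universal if every a.a. flow of $G$ is a factor of it. A compact flow $(G,X)$ is equicontinuous if for each entourage $\varepsilon$ of the uniformity of $X$ there is an entourage $\delta$ with $G\delta\subseteq\varepsilon$. $\mathscr{M}_{eq}$ is the minimal equicontinuous compact flow of $G$ having every minimal equicontinuous compact flow of $G$ as a factor. In the category of minimal compact flows of $G$, $\mathscr{X}$ is a maximal almost 1-1 extension of $\mathscr{M}_{eq}$ if $\mathscr{X}$ is an almost 1-1 extension of $\mathscr{M}_{eq}$ and every other almost 1-1 extension of $\mathscr{M}_{eq}$ is a factor of $\mathscr{X}$. *)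

(* Defs.v *)
From HB Require Import structures.
From mathcomp Require Import all_boot all_order all_algebra.
From mathcomp Require Import all_classical all_reals all_analysis.
From mathcomp Require Import complex ring.
Set Implicit Arguments.
Unset Strict Implicit.
Unset Printing Implicit Defensive.
Import Order.TTheory GRing.Theory Num.Theory.
Import numFieldNormedType.Exports.
Local Open Scope classical_set_scope.
Local Open Scope ring_scope.

(* ℂ over an abstract copy R of the real numbers; the type annotation selects
   the norm topology that every numFieldType carries. *)
Definition CC (R : realType) : numFieldType := R[i].

Record directedSet := DirectedSet {
  dir_sort :> Type;
  dir_le : dir_sort -> dir_sort -> Prop;
  dir_refl : forall i, dir_le i i;
  dir_trans : forall i j k, dir_le i j -> dir_le j k -> dir_le i k;
  dir_upper : forall i j, exists k, dir_le i k /\ dir_le j k;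
  dir_nonempty : exists i : dir_sort, True }.

(* A net in T is a function t : D -> T with D directed; it converges to x when
   t i @[i --> tails D] --> x. *)
Definition tails (D : directedSet) : set_system D :=
  filter_from setT (fun i : D => [set j : D | dir_le i j]).
Arguments tails : clear implicits.

Global Instance tails_filter (D : directedSet) : ProperFilter (tails D).
Proof.
apply: filter_from_proper; last by move=> i _; exists i; exact: dir_refl.
apply: filter_from_filter; first by have [i _] := dir_nonempty D; exists i.
move=> i j _ _; have [k [ik jk]] := dir_upper i j; exists k => // l kl.
by split; exact: dir_trans kl.
Qed.

(* The subnet of t : D -> T indexed by h is t \o h. The convergence says that
   h is eventually above every i in D; h need not be monotone. *)
Definition subnet_index (D E : directedSet) (h : E -> D) : Prop :=
  h @ tails E --> tails D.

HB.mixin Record isHausdorffLeftTopological G of Group G & Topological G := {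
  mulgl_continuous : forall y : G, continuous (fun x : G => (y * x)%g);
  group_hausdorff : hausdorff_space G }.

#[short(type="hltGroupType")]
HB.structure Definition HausdorffLeftTopologicalGroup :=
  {G of Group G & Topological G & isHausdorffLeftTopological G}.

Section function_spaces.
Variables (R : realType) (G : hltGroupType).
Implicit Types (f : G -> CC R) (t : G).

(* ltrans f t is the function ft, and rtrans t f is the function tf. *)
Definition ltrans f t : G -> CC R := fun x => f (t * x)%g.
Definition rtrans t f : G -> CC R := fun x => f (x * t)%g.

Definition LUC : set (G -> CC R) := [set f |
  [/\ exists M : CC R, forall x, `|f x| <= M,
      continuous f &
      forall (D : directedSet) (t : D -> G) (t0 : G),
        t i @[i --> tails D] --> t0 ->
        forall e : CC R, 0 < e -> \forall i \near tails D,
          forall x, `|ltrans f (t i) x - ltrans f t0 x| < e]].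

Definition left_almost_automorphic : set (G -> CC R) := [set f |
  forall (D : directedSet) (t : D -> G),
    exists (E : directedSet) (h : E -> D) (phi : G -> CC R),
      [/\ subnet_index h,
          continuous phi,
          forall x, rtrans (t (h i)) f x @[i --> tails E] --> phi x &
          forall x, rtrans (t (h i))^-1%g phi x @[i --> tails E] --> f x]].

Definition Vaa : set (G -> CC R) := left_almost_automorphic `&` LUC.

Lemma Vaa_ltrans f t : Vaa f -> Vaa (ltrans f t).
Proof.
move=> [faa [[M fM] fc fu]]; split.
  move=> D s; have [E [h [phi [hs phic fphi phif]]]] := faa D s.
  exists E, h, (ltrans phi t); split.
  - exact: hs.
  - by move=> x; exact: continuous_comp (mulgl_continuous t x) (phic _).
  - by move=> x; rewrite /ltrans /rtrans; under eq_fun do rewrite mulgA;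
      exact: fphi (t * x)%g.
  - by move=> x; rewrite /ltrans /rtrans; under eq_fun do rewrite mulgA;
      exact: phif (t * x)%g.
split.
- by exists M => x; exact: fM.
- by move=> x; exact: continuous_comp (mulgl_continuous t x) (fc _).
- move=> D s s0 ss0 e e0.
  have /fu /(_ e e0) : (t * s i)%g @[i --> tails D] --> (t * s0)%g.
    exact: cvg_comp ss0 (mulgl_continuous t s0).
  by apply: filterS => i sti x; rewrite /ltrans !mulgA; exact: sti.
Qed.

End function_spaces.

Record compactFlow (G : hltGroupType) := CompactFlow {
  flow_space :> topologicalType;
  act : G -> flow_space -> flow_space;
  act1 : forall x, act 1%g x = x;
  actM : forall s t x, act (s * t)%g x = act s (act t x);
  act_continuous : continuous (fun p : G * flow_space => act p.1 p.2);
  flow_compact : compact [set: flow_space];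
  flow_hausdorff : hausdorff_space flow_space }.

Section flows.
Variable G : hltGroupType.
Implicit Types X Y M : compactFlow G.

Definition orbit X (x : X) : set X := range (fun t : G => act t x).

Definition flow_hom X Y (phi : X -> Y) : Prop :=
  continuous phi /\ forall t x, phi (act t x) = act t (phi x).

Definition extension X Y (phi : X -> Y) : Prop :=
  flow_hom phi /\ forall y, exists x, phi x = y.

Definition factor Y X : Prop := exists phi : X -> Y, extension phi.

Definition endomorphism X (phi : X -> X) : Prop := flow_hom phi.

(* By compactness, a bijective endomorphism is a homeomorphism. *)
Definition automorphism X (phi : X -> X) : Prop :=
  endomorphism phi /\ bijective phi.

Definition minimal X : Prop :=
  [set: X] !=set0 /\ forall x : X, dense (orbit x).

Definition almost_one_one X Y (phi : X -> Y) : Prop :=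
  [/\ minimal X, minimal Y, extension phi &
      exists x, phi @^-1` [set phi x] = [set x]].

Definition aa_points X : set X := [set x |
  forall (D : directedSet) (t : D -> G) (y : X),
    act (t i) x @[i --> tails D] --> y ->
    act (t i)^-1%g y @[i --> tails D] --> x].

Definition aa_flow X : Prop := exists x : X, aa_points x /\ dense (orbit x).

Definition universal_aa_flow X : Prop :=
  aa_flow X /\ forall Y, aa_flow Y -> factor Y X.

(* A compact Hausdorff space has exactly one compatible uniformity; its
   entourages are the neighbourhoods of the diagonal. *)
Definition compact_entourage (X : topologicalType) : set_system (X * X) :=
  [set E | forall x : X, nbhs ((x, x) : X * X) E].

Definition equicontinuous_flow X : Prop :=
  forall E, compact_entourage E -> exists D : set (X * X),
    compact_entourage D /\
    forall t p, D p -> E (act t p.1, act t p.2).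

Definition universal_minimal_equicontinuous M : Prop :=
  [/\ minimal M, equicontinuous_flow M &
      forall Y, minimal Y -> equicontinuous_flow Y -> factor Y M].

Definition maximal_almost_one_one M X : Prop :=
  (exists phi : X -> M, almost_one_one phi) /\
  forall Y, (exists psi : Y -> M, almost_one_one psi) -> factor Y X.

End flows.

Section topology_facts.

Lemma hausdorff_injective (S T : topologicalType) (f : S -> T) :
  continuous f -> injective f -> hausdorff_space T -> hausdorff_space S.
Proof.
move=> fc finj hT x y xy; apply/finj/hT => A B /fc fA /fc fB.
by have [s [As Bs]] := xy _ _ fA fB; exists (f s).
Qed.

Lemma nbhs_set_type (T : topologicalType) (A : set T) (x : A) (U : set A) :
  nbhs x U -> exists2 W : set T, nbhs (val x) W & val @^-1` W `<=` U.
Proof.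
move=> [_ [[W oW <-] Wx WU]]; exists W => //.
by apply: open_nbhs_nbhs; split => //; move: Wx; rewrite set_valE.
Qed.

Lemma set_type_continuous (T : topologicalType) (A : set T) :
  continuous (val : A -> T).
Proof. by move=> x; exact: (@initial_continuous _ _ (set_val : A -> T)). Qed.

Lemma continuous_set_type (S T : topologicalType) (A : set T) (f : S -> A) :
  continuous (fun s => val (f s)) -> continuous f.
Proof.
move=> fc s U /nbhs_set_type [W Wx WU].
have fW : nbhs s (fun r => W (val (f r))) := fc s W Wx.
by apply: filterS fW => r; exact: WU.
Qed.

Lemma set_type_compact (T : topologicalType) (A : set T) (B : set A) :
  compact (val @` B) -> compact B.
Proof.
move=> cB F FF FB.
have vF (C : set A) : F C -> (val @ F) (val @` C).
  by move=> FC; apply: (@filterS _ F _ C _ _ FC) => z Cz; exists z.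
have [_ [[y By <-] ycl]] := cB _ (fmap_proper_filter val FF) (vF _ FB).
exists y; split => // C U FC /nbhs_set_type [W Wy WU].
have [_ [[z Cz <-] Wz]] := ycl _ W (vF _ FC) Wy.
by exists z; split => //; exact: WU.
Qed.

Lemma closure_set_type (T : topologicalType) (A : set T) (B : set A) (x : A) :
  closure (val @` B) (val x) -> closure B x.
Proof.
move=> xcl U /nbhs_set_type [W Wy WU].
have [_ [[z Bz <-] Wz]] := xcl W Wy.
by exists z; split => //; exact: WU.
Qed.

Lemma ptws_cvg (S I : Type) (T : topologicalType) (F : set_system S)
    (FF : Filter F) (f : S -> {ptws I -> T}) (g : {ptws I -> T}) :
  (forall i, f s i @[s --> F] --> g i) -> f @ F --> g.
Proof.
move=> fg; apply/cvg_sup => i U [_ [[W oW <-] Wg WU]].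
have fW : F (fun s => W (f s i)) := fg i W (open_nbhs_nbhs (conj oW Wg)).
by apply: filterS fW => s; exact: WU.
Qed.

Lemma ptws_eval_continuous (I : choiceType) (T : topologicalType) (i : I) :
  continuous (fun f : {ptws I -> T} => f i).
Proof. exact: proj_continuous. Qed.

Lemma ptws_hausdorff (I : choiceType) (T : topologicalType) :
  hausdorff_space T -> hausdorff_space {ptws I -> T}.
Proof. by move=> hT; exact: hausdorff_product. Qed.

End topology_facts.

Section flow_constructions.
Variable G : hltGroupType.
Implicit Types X : compactFlow G.

Lemma act_cvg X (S : Type) (F : set_system S) (FF : Filter F) (t : S -> G)
    (x : S -> X) (t0 : G) (x0 : X) :
  t @ F --> t0 -> x @ F --> x0 -> act (t s) (x s) @[s --> F] --> act t0 x0.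
Proof. by move=> tt0 xx0; apply: cvg_comp (cvg_pair tt0 xx0) (@act_continuous G X (t0, x0)). Qed.

Lemma act_continuous2 X t : continuous (act t : X -> X).
Proof. by move=> x; apply: act_cvg; [exact: cvg_cst|exact: cvg_id]. Qed.

Section power.
Variables (I : choiceType) (X : compactFlow G).

Definition power_act (t : G) (f : {ptws I -> X}) : {ptws I -> X} :=
  fun i => act t (f i).

Lemma power_act1 f : power_act 1%g f = f.
Proof. by apply/funext => i; exact: act1. Qed.

Lemma power_actM s t f : power_act (s * t)%g f = power_act s (power_act t f).
Proof. by apply/funext => i; exact: actM. Qed.

Lemma power_act_continuous :
  continuous (fun p : G * {ptws I -> X} => power_act p.1 p.2).
Proof.
move=> [t f]; apply: ptws_cvg => i.
have evf : p.2 i @[p --> nbhs ((t, f) : G * {ptws I -> X})] --> f i.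
  apply: (@cvg_comp _ _ _ snd (fun g : {ptws I -> X} => g i) _ (nbhs f)).
    exact: cvg_snd.
  exact: ptws_eval_continuous.
have := @act_cvg X _ (nbhs ((t, f) : G * {ptws I -> X})) _
  fst (fun p => p.2 i) t (f i) cvg_fst evf.
exact.
Qed.

Lemma power_compact : compact [set: {ptws I -> X}].
Proof.
have /tychonoff : forall i : I, compact [set: X] by move=> _; exact: flow_compact.
by congr compact; apply/seteqP; split.
Qed.

Definition power_flow : compactFlow G :=
  CompactFlow power_act1 power_actM power_act_continuous power_compact
    (ptws_hausdorff (@flow_hausdorff G X)).

End power.

Section orbit_closure.
Variables (X : compactFlow G) (x : X).

Let S : set X := closure (orbit x).

Lemma orbit_closure_act t y : y \in S -> act t y \in S.
Proof.
move=> /set_mem yS; apply/mem_set => U /(@act_continuous2 X t y) /yS.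
by move=> [_ [[s _ <-] Us]]; exists (act (t * s)%g x); split;
  [exists (t * s)%g|rewrite actM].
Qed.

Definition orbit_act (t : G) (y : S) : S :=
  exist _ (act t (val y)) (orbit_closure_act t (valP y)).

Lemma orbit_act1 y : orbit_act 1%g y = y.
Proof. by apply: val_inj; exact: act1. Qed.

Lemma orbit_actM s t y : orbit_act (s * t)%g y = orbit_act s (orbit_act t y).
Proof. by apply: val_inj; exact: actM. Qed.

Lemma orbit_act_continuous :
  continuous (fun p : G * S => orbit_act p.1 p.2).
Proof.
apply: continuous_set_type => -[t y].
have valy : val p.2 @[p --> nbhs ((t, y) : G * S)] --> val y.
  apply: (@cvg_comp _ _ _ snd (fun z : S => val z) _ (nbhs y)).
    exact: cvg_snd.
  exact: set_type_continuous.
exact: (@act_cvg X _ _ _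
  fst (fun p : G * S => val p.2) t (val y) cvg_fst valy).
Qed.

Lemma orbit_closure_compact : compact [set: S].
Proof.
apply: set_type_compact.
suff -> : val @` [set: S] = S.
  by apply: subclosed_compact (@flow_compact G X) _ => //; exact: closed_closure.
apply/seteqP; split => [_ [y _ <-]|y Sy]; first exact: set_mem (valP y).
by exists (exist _ y (mem_set Sy)).
Qed.

Definition orbit_closure : compactFlow G :=
  CompactFlow orbit_act1 orbit_actM orbit_act_continuous orbit_closure_compact
    (hausdorff_injective (@set_type_continuous _ _) val_inj
       (@flow_hausdorff G X)).

End orbit_closure.
End flow_constructions.

(* The net of all pairs (U, x) with U in F and x in U, ordered by reverse
   inclusion of U; its tails generate F. *)
Section net_of_filter.
Variables (T : Type) (F : set_system T) (FF : ProperFilter F).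

Let I := {p : set T * T | F p.1 /\ p.1 p.2}.
Let le (i j : I) : Prop := (sval j).1 `<=` (sval i).1.

Lemma filter_dir_upper i j : exists k, le i k /\ le j k.
Proof.
case: i j => [[U x] /= [FU Ux]] [[W y] /= [FW Wy]].
have FUW : F (U `&` W) by exact: filterI.
have [z UWz] := filter_ex FUW.
by exists (exist _ (U `&` W, z) (conj FUW UWz)); split => // w [].
Qed.

Lemma filter_dir_nonempty : exists i : I, True.
Proof.
have FT : F setT by exact: filterT.
have [z _] := filter_ex FT.
by exists (exist _ (setT, z) (conj FT Logic.I)).
Qed.

Definition filter_dir : directedSet :=
  @DirectedSet I le (fun i x => id) (fun i j k ij jk => subset_trans jk ij)
    filter_dir_upper filter_dir_nonempty.

Definition filter_net (i : filter_dir) : T := (sval i).2.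

Lemma filter_netE : filter_net @ tails filter_dir = F.
Proof.
apply/seteqP; split=> [A [[[U x] /= [FU Ux]] _ UA]|A FA].
  apply: (filterS _ FU) => y Uy.
  by have := UA (exist _ (U, y) (conj FU Uy)); apply => z.
have [x Ax] := filter_ex FA.
exists (exist _ (A, x) (conj FA Ax)) => // -[[U y] [FU Uy]] /= UA.
exact: UA.
Qed.

End net_of_filter.

Section complex_facts.
Variable R : realType.

Lemma real_complex_continuous : continuous (fun a : R => (a%:C)%C : CC R).
Proof.
move=> a; apply/cvgrPdist_lt => e e0.
have re : e = ((complex.Re e)%:C)%C by case: e e0 => x y; rewrite ltcE /= => /andP[/eqP ->].
have re0 : 0 < complex.Re e by move: e0; rewrite ltcE => /andP[].
apply: filterS (nbhsx_ballx a _ re0) => b; rewrite -ball_normE /= => ab.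
rewrite re.
have -> : (a%:C)%C - (b%:C)%C = ((a - b)%:C)%C :> R[i] by rewrite rmorphB.
by rewrite normc_def /= expr0n /= addr0 sqrtr_sqr ltcR.
Qed.

Definition csquare (M : CC R) : set (CC R) :=
  [set c | exists a b : R, [/\ `|a| <= complex.Re M, `|b| <= complex.Re M &
     c = (a%:C)%C + 'i%C * (b%:C)%C]].

Lemma csquare_compact M : compact (csquare M).
Proof.
pose I := `[- complex.Re M, complex.Re M]%classic : set R.
have cI : compact I by exact: segment_compact.
pose g (p : R * R) : CC R := (p.1%:C)%C + 'i%C * (p.2%:C)%C.
have cg : continuous g.
  move=> [a b]; have c1 : continuous_at (a, b) (fun q : R * R => (q.1%:C)%C : CC R).
    apply: (@cvg_comp _ _ _ fst (fun x : R => (x%:C)%C : CC R) _ (nbhs a)).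
      exact: cvg_fst.
    exact: real_complex_continuous.
  have c2 : continuous_at (a, b) (fun q : R * R => (q.2%:C)%C : CC R).
    apply: (@cvg_comp _ _ _ snd (fun x : R => (x%:C)%C : CC R) _ (nbhs b)).
      exact: cvg_snd.
    exact: real_complex_continuous.
  by apply: (cvgD c1); apply: (cvgM _ c2); exact: cvg_cst.
have := continuous_compact (continuous_subspaceT cg) (compact_setX cI cI).
congr compact; apply/seteqP; split => [_ [[a b] [/= aI bI] <-]|_ [a [b [aM bM ->]]]].
  exists a, b; split => //; rewrite ler_norml;
    [move: aI|move: bI]; by rewrite /I /= in_itv.
exists (a, b) => //; split; rewrite /I /= in_itv /= -ler_norml; [exact: aM|exact: bM].
Qed.

Lemma csquare_norm M (c : CC R) : `|c| <= M -> csquare M c.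
Proof.
case: c => a b; rewrite normc_def lecE /= => /andP[_ abM].
exists a, b; split.
- apply: le_trans abM; rewrite -sqrtr_sqr; apply: ler_wsqrtr.
  by rewrite lerDl sqr_ge0.
- apply: le_trans abM; rewrite -sqrtr_sqr; apply: ler_wsqrtr.
  by rewrite lerDr sqr_ge0.
- by rewrite [LHS]complexE.
Qed.

End complex_facts.

Section canonical_flow.
Variables (R : realType) (G : hltGroupType).

Let V : set (G -> CC R) := @Vaa R G.

Definition Vaa_translate (f : V) (t : G) : V :=
  exist _ (ltrans (val f) t) (mem_set (Vaa_ltrans t (set_mem (valP f)))).

(* The dual space of V for the sup norm. As a subtype of {ptws V -> CC R} it
   carries the topology of pointwise convergence, i.e. the weak-* topology.
   Linearity is stated relationally because the type V is not given a vector
   space structure; c ranges over the upper bounds of the sup norm of f. *)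
Definition Vaa_dual : set {ptws V -> CC R} := [set mu |
  (forall (a : CC R) (f g h : V),
     (forall x, val h x = a * val f x + val g x) -> mu h = a * mu f + mu g) /\
  exists M : CC R, forall (f : V) (c : CC R),
     (forall x, `|val f x| <= c) -> `|mu f| <= M * c].

Lemma point_eval_dual (t : G) : Vaa_dual (fun f : V => val f t).
Proof.
split=> [a f g h ->//|]; exists 1 => f c fc.
by rewrite mul1r.
Qed.

Definition point_eval (t : G) : Vaa_dual :=
  exist _ (fun f : V => val f t) (mem_set (point_eval_dual t)).

Lemma dual_translate (t : G) (mu : {ptws V -> CC R}) :
  Vaa_dual mu -> Vaa_dual (fun f => mu (Vaa_translate f t)).
Proof.
move=> [lin [M muM]]; split.
  by move=> a f g h hfg; apply: lin => x; exact: hfg.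
by exists M => f c fc; apply: muM => x; exact: fc.
Qed.

Definition dual_act (t : G) (mu : Vaa_dual) : Vaa_dual :=
  exist _ (fun f => val mu (Vaa_translate f t))
    (mem_set (dual_translate t (set_mem (valP mu)))).

Definition Ma_set : set Vaa_dual := closure (range point_eval).

Lemma dual_eval_continuous (f : V) :
  continuous (fun mu : Vaa_dual => val mu f).
Proof.
move=> mu.
apply: (@cvg_comp _ _ _ (fun nu : Vaa_dual => val nu)
  (fun m : {ptws V -> CC R} => m f) _ (nbhs (val mu))).
  exact: set_type_continuous.
have H := @ptws_eval_continuous V (CC R) f (val mu).
exact: H.
Qed.

Lemma dual_act_continuous t : continuous (dual_act t).
Proof.
apply: continuous_set_type => mu; apply: (@ptws_cvg _ _ _ (nbhs mu) _) => f.
exact: (@dual_eval_continuous (Vaa_translate f t) mu).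
Qed.

Lemma Ma_set_act t mu : mu \in Ma_set -> dual_act t mu \in Ma_set.
Proof.
move=> /set_mem muM; apply/mem_set => U /(@dual_act_continuous t mu) /muM.
move=> [_ [[s _ <-] Us]]; exists (point_eval (t * s)%g); split; first by exists (t * s)%g.
by congr U: Us; apply: val_inj.
Qed.

Definition Ma_act (t : G) (mu : Ma_set) : Ma_set :=
  exist _ (dual_act t (val mu)) (Ma_set_act t (valP mu)).

Lemma Ma_ext (mu nu : Ma_set) :
  (forall f, val (val mu) f = val (val nu) f) -> mu = nu.
Proof. by move=> e; do 2 apply: val_inj; apply/funext. Qed.

Lemma Ma_act1 mu : Ma_act 1%g mu = mu.
Proof.
apply: Ma_ext => f /=; congr (val (val mu) _); apply: val_inj.
by apply/funext => x; rewrite /= /ltrans mul1g.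
Qed.

Lemma Ma_actM s t mu : Ma_act (s * t)%g mu = Ma_act s (Ma_act t mu).
Proof.
apply: Ma_ext => f /=; congr (val (val mu) _); apply: val_inj.
by apply/funext => x; rewrite /= /ltrans mulgA.
Qed.

Lemma Ma_eval_continuous (f : V) :
  continuous (fun mu : Ma_set => val (val mu) f).
Proof.
move=> mu; apply: (@cvg_comp _ _ _ (fun nu : Ma_set => val nu)
  (fun nu : Vaa_dual => val nu f) _ (nbhs (val mu))).
  exact: set_type_continuous.
exact: dual_eval_continuous.
Qed.

Lemma Ma_dist (mu : Ma_set) (f g : V) (c : CC R) :
  (forall x, `|val f x - val g x| <= c) ->
  `|val (val mu) f - val (val mu) g| <= c.
Proof.
move=> fgc; apply/ler_addgt0Pr => e e0.
have e20 : 0 < e / 2 by rewrite divr_gt0.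
have nf (h : V) : nbhs (val mu)
    (fun nu : Vaa_dual => `|val (val mu) h - val nu h| < e / 2).
  have H : val nu h @[nu --> nbhs (val mu)] --> val (val mu) h.
    exact: dual_eval_continuous.
  by move/cvgrPdist_lt: H => /(_ _ e20).
have [_ [[s _ <-] [/= fs gs]]] := set_mem (valP mu) _ (filterI (nf f) (nf g)).
move: fs gs; set a := val (val mu) f; set b := val (val mu) g => fs gs.
have -> : a - b = (val f s - val g s) + ((a - val f s) - (b - val g s)).
  by ring.
apply: (le_trans (ler_normD _ _)); apply: lerD; first exact: fgc.
apply: (le_trans (ler_normB _ _)); rewrite (splitr e).
by apply: lerD; apply: ltW.
Qed.

Lemma LUC_near (f : V) (t : G) (e : CC R) : 0 < e ->
  \forall s \near t, forall x, `|ltrans (val f) s x - ltrans (val f) t x| < e.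
Proof.
move=> e0; have [_ [_ _ fu]] := set_mem (valP f).
pose D := filter_dir (nbhs_pfilter t).
pose n : D -> G := @filter_net _ _ (nbhs_pfilter t).
have nt : n @ tails D --> t by rewrite filter_netE; exact: cvg_id.
have : (n @ tails D) [set s | forall x,
    `|ltrans (val f) s x - ltrans (val f) t x| < e] := fu D n t nt e e0.
by rewrite filter_netE.
Qed.

Lemma Ma_act_continuous : continuous (fun p : G * Ma_set => Ma_act p.1 p.2).
Proof.
do 2 apply: continuous_set_type; move=> [t mu].
apply: (@ptws_cvg _ _ _ (nbhs ((t, mu) : G * Ma_set)) _) => f.
apply/cvgrPdist_lt => e e0.
have e20 : 0 < e / 2 by rewrite divr_gt0.
have /cvgrPdist_lt/(_ _ e20) nmu :=
  @Ma_eval_continuous (Vaa_translate f t) mu.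
exists ([set s | forall x, `|ltrans (val f) s x - ltrans (val f) t x| < e / 2],
  [set nu : Ma_set | `|val (val mu) (Vaa_translate f t)
                       - val (val nu) (Vaa_translate f t)| < e / 2]).
  by split; [exact: LUC_near|exact: nmu].
move=> [s nu] [/= sx nux].
set a := val (val mu) _ in nux *.
rewrite (splitr e) -(subrKA (val (val nu) (Vaa_translate f t)) a).
apply: (le_lt_trans (ler_normD _ _)); apply: ltr_leD; first exact: nux.
apply: Ma_dist => x; rewrite distrC; apply: ltW; exact: sx.
Qed.

Lemma Ma_set_eval : val @` Ma_set = closure (val @` range point_eval).
Proof.
apply/seteqP; split.
  move=> _ [mu muM <-] U /(@set_type_continuous _ Vaa_dual mu) /muM.
  by move=> [nu [rnu Unu]]; exists (val nu); split => //; exists nu.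
move=> m mcl.
suff dm : Vaa_dual m.
  exists (exist _ m (mem_set dm)) => //; apply: closure_set_type; exact: mcl.
have near3 (f g h : V) (e : CC R) : 0 < e -> exists t : G,
    [/\ `|m f - val f t| < e, `|m g - val g t| < e & `|m h - val h t| < e].
  move=> e0.
  have nf (k : V) : nbhs m (fun n : {ptws V -> CC R} => `|m k - n k| < e).
    by have /cvgrPdist_lt := @ptws_eval_continuous V (CC R) k m; exact.
  have [_ [[_ [t _ <-] <-] [[/= ? ?] ?]]] :=
    mcl _ (filterI (filterI (nf f) (nf g)) (nf h)).
  by exists t.
split.
  move=> a f g h hfg; apply/subr0_eq/normr0_eq0/le_anti; rewrite normr_ge0 andbT.
  apply/ler_addgt0Pr => e e0; rewrite add0r.
  have d0 : 0 < 2 + `|a| by rewrite ltr_wpDr.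
  have [t [ft gt ht]] := near3 f g h _ (divr_gt0 e0 d0).
  have -> : m h - (a * m f + m g) =
      (m h - val h t) - (a * (m f - val f t) + (m g - val g t)).
    by rewrite hfg; ring.
  apply: (le_trans (ler_normB _ _)).
  have -> : e = e / (2 + `|a|) + (`|a| * (e / (2 + `|a|)) + e / (2 + `|a|)).
    by field; rewrite gt_eqF.
  apply: lerD; first exact: ltW.
  apply: (le_trans (ler_normD _ _)); apply: lerD; last exact: ltW.
  by rewrite normrM ler_wpM2l// ltW.
exists 1 => f c fc; rewrite mul1r; apply/ler_addgt0Pr => e e0.
have [t [ft _ _]] := near3 f f f e e0.
rewrite -(subrK (val f t) (m f)) addrC.
by apply: (le_trans (ler_normD _ _)); apply: lerD; [exact: fc|exact: ltW].
Qed.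

Lemma Ma_compact : compact [set: Ma_set].
Proof.
have valT (T : Type) (A : set T) : val @` [set: A] = A.
  apply/seteqP; split => [_ [y _ <-]|y Ay]; first exact: set_mem (valP y).
  by exists (exist _ y (mem_set Ay)).
do 2 apply: set_type_compact; rewrite valT Ma_set_eval.
have bd (f : V) : {M : CC R | forall x, `|val f x| <= M}.
  by apply: cid; have [_ [[M fM] _ _]] := set_mem (valP f); exists M.
pose K := [set m : forall _ : V, CC R | forall f, csquare (sval (bd f)) (m f)].
have cK : compact (K : set {ptws V -> CC R}).
  apply: (@tychonoff V (fun=> CC R) (fun f => csquare (sval (bd f)))) => f.
  exact: csquare_compact.
have clK : closed (K : set {ptws V -> CC R}).
  by apply: compact_closed cK; apply: ptws_hausdorff; exact: norm_hausdorff.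
apply: subclosed_compact cK _; first exact: closed_closure.
rewrite ((closure_id (K : set {ptws V -> CC R})).1 clK); apply: closureS.
by move=> _ [_ [t _ <-] <-] f; apply/csquare_norm/(svalP (bd f)).
Qed.

Lemma Ma_hausdorff : hausdorff_space Ma_set.
Proof.
do 2 apply: (hausdorff_injective (@set_type_continuous _ _) val_inj).
exact: ptws_hausdorff (@norm_hausdorff _ _).
Qed.

Definition Ma : compactFlow G :=
  CompactFlow Ma_act1 Ma_actM Ma_act_continuous Ma_compact Ma_hausdorff.

End canonical_flow.

Section aa_power.
Variables (R : realType) (G : hltGroupType).

Definition Ma_aa : set (Ma R G) := @aa_points G (Ma R G).

Definition Ma_power : compactFlow G := power_flow Ma_aa (Ma R G).

Definition zpoint : Ma_power := fun a : Ma_aa => val a.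

Definition Zflow : compactFlow G := orbit_closure zpoint.

(* The point xi of Z, viewed as a map from A to M_a. *)
Definition Zmap (xi : Zflow) : Ma_aa -> Ma R G := val (xi : closure (orbit zpoint)).

End aa_power.
Arguments Ma_aa : clear implicits.

(* Main.v *)
Require Import Defs.
From mathcomp Require Import all_boot all_order all_algebra.
From mathcomp Require Import all_classical all_reals all_analysis.
From mathcomp Require Import complex.
(* Restores the meaning of [orbit] for flows, against orbits of functions on
   finite types. *)
Import Defs.
Import Order.TTheory GRing.Theory Num.Theory.
Import numFieldNormedType.Exports.

Local Open Scope classical_set_scope.

(** The comparison with [Meq] and the uniqueness of universal a.a. flows rest on
    one description of an a.a. flow [X] with a.a. point [x0] of dense orbit: [X] has an equicontinuous factor
    [pi : X -> Q] whose fibre over [pi x0] is the point [x0], and every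
    homomorphism from [X] to an equicontinuous flow factors through [pi]
    ([aa_equicontinuous_factor]).

    To find [Q], consider for a neighbourhood [U] of [x0] the return times
    [N(U) = {t | t x0 in U}].  Since [t_n x0 -> y] implies [t_n^-1 y -> x0], every
    sequence [gam] in [G] has indices [m < n] with [gam_m^-1 gam_n] in [N(U)].
    Applied to a sequence of products of return times, this yields a
    neighbourhood [V] of [x0] with [N(V)^-1 N(V)] inside [N(U)]
    ([aa_return_quotient]).  By density of the orbit, the translates of [V] then
    star-refine those of [U] ([aa_star_refinement]), so the coverings of [X] by the translates of the
    neighbourhoods of [x0] generate an invariant uniformity, coarser than the
    topology; [Q] is the Hausdorff quotient of [X] for it.

    The second ingredient is that an endomorphism [phi] of a minimal
    equicontinuous flow is injective, because powers of [phi] come uniformly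
    close to the identity ([equicontinuous_endomorphism_injective]).  If [X] is
    as above, [f : X -> W] is an extension and [g : W -> Q] a homomorphism, then
    [g f] induces an endomorphism of [Q]; its injectivity shows that [f] is
    injective over [f x0], that is, almost one-to-one.  This applies to extensions
    of a universal a.a. flow onto [Meq] and onto another universal a.a. flow.
    Conversely, a point with a one-point fibre over an equicontinuous flow is
    a.a., so almost one-to-one extensions of [Meq] are a.a. flows.

    For the universality of [Ma], evaluation at [1] is an a.a. point because the
    functions in the algebra are left almost automorphic.  If [y0] is an a.a. point
    of a flow [Y], the functions [t |-> F (t y0)] with [F] continuous on [Y] lie in
    the algebra; hence [t y0] converges whenever [t^*] converges in [Ma], and the
    map [t^* |-> t y0] extends to [Ma].

    For the endomorphisms [phi] of [Ma] in the theorem, composing [eta \o phi] with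
    the evaluation at a suitable [b] in [A] gives an endomorphism of [Ma] that fixes [a], hence is the
    identity. *)

Set Implicit Arguments.
Unset Strict Implicit.
Unset Printing Implicit Defensive.

(** * Filters, compact flows and entourages *)

Lemma nbhs_pair_preimage (S T : topologicalType) (f : S -> T) (p q : S)
    (U : set (T * T)) : continuous f ->
  nbhs ((f p, f q) : T * T) U -> nbhs ((p, q) : S * S) [set r | U (f r.1, f r.2)].
Proof.
move=> cf [[A B] /= [pA qB] ABU].
exists (f @^-1` A, f @^-1` B); first by split; [exact: cf|exact: cf].
by move=> [r s] [/= Ar Bs]; exact: ABU.
Qed.

Section flow_basics.
Variable G : hltGroupType.
Implicit Types X Y Z M : compactFlow G.

Lemma actK X (t : G) : cancel (@act G X t) (act t^-1%g).
Proof. by move=> x; rewrite -actM mulVg act1. Qed.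

Lemma orbit_map_continuous X (x : X) : continuous (fun t : G => act t x).
Proof. by move=> t; apply: act_cvg; [exact: cvg_id|exact: cvg_cst]. Qed.

Lemma nbhs_act X (t : G) (x : X) (U : set X) :
  nbhs (act t x) U -> nbhs x (fun y => U (act t y)).
Proof. by move=> U0; exact: (@act_continuous2 G X t x). Qed.

Lemma dense_orbit_nbhs X (x y : X) (U : set X) :
  dense (orbit x) -> nbhs y U -> exists t : G, U (act t x).
Proof.
move=> dx; rewrite nbhsE => -[W [oW Wy] WU].
have [z [Wz [t _ tz]]] := dx W (ex_intro _ y Wy) oW.
by exists t; apply: WU; rewrite tz.
Qed.

Lemma dense_orbitP X (x : X) :
  (forall (y : X) (U : set X), nbhs y U -> exists t : G, U (act t x)) ->
  dense (orbit x).
Proof.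
move=> h O [y Oy] oO.
have [t Ot] := h y O (open_nbhs_nbhs (conj oO Oy)).
by exists (act t x); split => //; exists t.
Qed.

Lemma nbhs_closed_nbhs X (x : X) (U : set X) : nbhs x U ->
  exists C : set X, [/\ nbhs x C, closed C & C `<=` U].
Proof.
move=> xU.
have [V xV VU] := compact_regular (@flow_hausdorff G X) (@flow_compact G X)
  (filterT : nbhs x setT) xU.
exists (closure V); split => //; last exact: closed_closure.
exact: filterS (@subset_closure _ V) xV.
Qed.

Lemma compact_ultra_cvg X (S : Type) (F : set_system S) (f : S -> X) :
  UltraFilter F -> exists y : X, f s @[s --> F] --> y.
Proof.
move=> UF; have := @flow_compact G X; rewrite compact_ultra.
move=> /(_ (f @ F) _ (@filterT _ _ _)) [|y [_ fy]]; last by exists y.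
split => [|H PH fFH]; first exact: fmap_proper_filter.
apply/seteqP; split => A; last exact: fFH.
move=> HA; have [//|FnA] := in_ultra_setVsetC (f @^-1` A) UF.
by have /filter_ex [? []] : H (A `&` ~` A) by apply: filterI => //; exact: fFH.
Qed.

Lemma flow_hom_comp X Y Z (f : X -> Y) (g : Y -> Z) :
  flow_hom f -> flow_hom g -> flow_hom (g \o f).
Proof.
move=> [cf ef] [cg eg]; split => [x|t x]; last by rewrite /= ef eg.
by apply: continuous_comp; [exact: cf|exact: cg].
Qed.

Lemma extension_comp X Y Z (f : X -> Y) (g : Y -> Z) :
  extension f -> extension g -> extension (g \o f).
Proof.
move=> [hf sf] [hg sg]; split => [|z]; first exact: flow_hom_comp.
by have [y <-] := sg z; have [x <-] := sf y; exists x.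
Qed.

Lemma flow_hom_closed X Y (f : X -> Y) (C : set X) :
  continuous f -> closed C -> closed (f @` C).
Proof.
move=> cf cC; apply: compact_closed; first exact: flow_hausdorff.
apply: continuous_compact; first exact: continuous_subspaceT.
by apply: (subclosed_compact cC (@flow_compact G X)).
Qed.

Lemma flow_hom_eq X Y (f g : X -> Y) (x : X) :
  flow_hom f -> flow_hom g -> dense (orbit x) -> f x = g x -> f =1 g.
Proof.
move=> [cf ef] [cg eg] dx fgx y; apply: (@flow_hausdorff G Y) => A B fA gB.
have [t [At Bt]] :=
  dense_orbit_nbhs dx (@filterI _ (nbhs y) _ _ _ (cf y _ fA) (cg y _ gB)).
by exists (f (act t x)); split => //; rewrite ef fgx -eg.
Qed.

Lemma flow_hom_surj X Y (f : X -> Y) (x : X) :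
  flow_hom f -> dense (orbit (f x)) -> extension f.
Proof.
move=> [cf ef] dfx; split => // y.
have : closure (f @` setT) y.
  move=> U yU; have [t Ut] := dense_orbit_nbhs dfx yU.
  by exists (act t (f x)); split => //; exists (act t x).
by move/(flow_hom_closed cf closedT) => [z _ <-]; exists z.
Qed.

Lemma flow_hom_dense X Y (f : X -> Y) (x : X) :
  extension f -> dense (orbit x) -> dense (orbit (f x)).
Proof.
move=> [[cf ef] sf] dx; apply: dense_orbitP => y U.
have [z <-] := sf y; move=> /cf /(dense_orbit_nbhs dx) [t Ut].
by exists t; rewrite -ef.
Qed.

Lemma factor_minimal X Y (f : X -> Y) : extension f -> minimal X -> minimal Y.
Proof.
move=> ef [[x _] mX]; split; first by exists (f x).
by have [_ sf] := ef; move=> y; have [z <-] := sf y; exact: flow_hom_dense.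
Qed.

Lemma minimal_hom_extension X Y (f : X -> Y) :
  minimal X -> minimal Y -> flow_hom f -> extension f.
Proof. by move=> [[x _] _] [_ mY] hf; exact: (@flow_hom_surj _ _ f x). Qed.

(** A continuous surjection between compact Hausdorff spaces is closed, hence a
    quotient map. *)
Lemma flow_hom_factor X Y Z (p : X -> Y) (f : X -> Z) :
  extension p -> flow_hom f -> (forall x y, p x = p y -> f x = f y) ->
  exists2 g : Y -> Z, flow_hom g & g \o p = f.
Proof.
move=> [[cp ep] sp] [cf ef] pf.
have [s sK] : exists s : Y -> X, cancel s p by have [s] := choice sp; exists s.
have gp x : f (s (p x)) = f x by apply: pf; rewrite sK.
exists (f \o s); last by apply/funext => x; exact: gp.
split => [|t y]; last by rewrite /= -[in LHS](sK y) -ep gp ef.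
apply/continuous_closedP => C cC.
have -> : (f \o s) @^-1` C = p @` (f @^-1` C).
  apply/seteqP; split => [y Cy|_ [x Cx <-]]; first by exists (s y).
  by rewrite /= gp.
by apply: flow_hom_closed => //; move/continuous_closedP: cf; exact.
Qed.

Lemma compact_entourage_point X (x : X) (U : set X) : nbhs x U ->
  compact_entourage [set p : X * X | p.1 = x -> U p.2].
Proof.
move=> xU y; have [->|yx] := pselect (y = x).
  by exists (setT, U) => [|[p q] [_ Uq] _]; first by split => //; exact: filterT.
exists (~` [set x], setT); last by move=> [p q] [px _] /px.
split; last exact: filterT.
apply: open_nbhs_nbhs; split => //; rewrite openC.
exact: accessible_closed_set1 (hausdorff_accessible (@flow_hausdorff G X)) _.
Qed.

Lemma compact_entourage_section X (D : set (X * X)) (p : X) :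
  compact_entourage D -> nbhs p [set q | D (p, q)].
Proof.
move=> /(_ p) Dp; have cp : (p, q) @[q --> p] --> ((p, p) : X * X).
  by apply: cvg_pair; [exact: cvg_cst|exact: cvg_id].
exact: cp Dp.
Qed.

Lemma compact_entourageI X (D E : set (X * X)) :
  compact_entourage D -> compact_entourage E -> compact_entourage (D `&` E).
Proof. by move=> cD cE x; apply: filterI; [exact: cD|exact: cE]. Qed.

(** The diagonal is closed, and the square, being compact Hausdorff, is normal. *)
Lemma compact_entourage_closed X (E : set (X * X)) : compact_entourage E ->
  exists D : set (X * X), [/\ compact_entourage D, closed D & D `<=` E].
Proof.
move=> cE; pose dg := [set p : X * X | p.1 = p.2].
have cXX : compact [set: X * X].
  by rewrite -setXTT; apply: compact_setX; exact: flow_compact.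
have hXX : hausdorff_space (X * X)%type.
  move=> [p q] [p' q'] pq; congr pair; apply: (@flow_hausdorff G X) => A B pA qB.
    have [] := pq (A `*` setT) (B `*` setT).
    - by exists (A, setT) => //; split => //; exact: filterT.
    - by exists (B, setT) => //; split => //; exact: filterT.
    - by move=> [u v] [/= [Au _] [Bu _]]; exists u.
  have [] := pq (setT `*` A) (setT `*` B).
  - by exists (setT, A) => //; split => //; exact: filterT.
  - by exists (setT, B) => //; split => //; exact: filterT.
  - by move=> [u v] [/= [_ Av] [_ Bv]]; exists v.
have cdg : closed dg.
  move=> [p q] pq; apply: (@flow_hausdorff G X) => A B pA qB.
  have [[u v] [uv [/= Au Bv]]] : exists r, (dg `&` (A `*` B)) r.
    by apply: pq; exists (A, B).
  by exists u; split => //; rewrite (uv : u = v).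
have dgE : set_nbhs dg E by move=> [p q] pq; rewrite (pq : p = q); exact: cE.
have [D dgD DE] := compact_normal hXX cXX cdg dgE.
exists (closure D); split => //; last exact: closed_closure.
by move=> x; apply: filterS (@subset_closure _ D) _; exact: dgD.
Qed.

End flow_basics.

(** * Almost automorphic points *)

Section aa_points_theory.
Variable G : hltGroupType.
Implicit Types X Y M : compactFlow G.

(** Every proper filter is generated by the tails of a net, so the definition
    of a.a. points by nets can be used along arbitrary filters. *)
Lemma aa_filter X (x y : X) (S : Type) (F : set_system S) (t : S -> G) :
  ProperFilter F -> aa_points x ->
  act (t s) x @[s --> F] --> y -> act (t s)^-1%g y @[s --> F] --> x.
Proof.
move=> FF ax txy.
have netE (T : topologicalType) (f : S -> T) :
    f (filter_net i) @[i --> tails (filter_dir FF)] = f s @[s --> F].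
  by apply/seteqP; split => A; rewrite -[in f s @[s --> F]](filter_netE FF).
have := ax (filter_dir FF) (t \o @filter_net _ _ FF) y.
by rewrite /= (netE _ (fun s => act (t s) x))
  (netE _ (fun s => act (t s)^-1%g y)); apply.
Qed.

(** The orbit of [x] accumulates at any [y], and the inverse translates of
    [y] lead back to [x]; so every orbit closure contains [x]. *)
Lemma aa_dense_minimal X (x : X) : aa_points x -> dense (orbit x) -> minimal X.
Proof.
move=> ax dx; split; first by exists x.
move=> y; apply: dense_orbitP => z U zU.
pose F := filter_from (nbhs y) (fun W => [set t : G | W (act t x)]).
have FF : ProperFilter F.
  apply: filter_from_proper; last first.
    by move=> W /(dense_orbit_nbhs dx) [t Wt]; exists t.
  apply: filter_from_filter; first by exists setT; exact: filterT.
  by move=> A B yA yB; exists (A `&` B) => //; exact: filterI.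
have Fy : act t x @[t --> F] --> y by move=> W yW; exists W.
have [s Us] := dense_orbit_nbhs dx (nbhs_interior zU).
have Ft : F [set t | U (act s (act t^-1%g y))] := aa_filter FF ax Fy (nbhs_act Us).
have [t Ut] := filter_ex Ft.
by exists (s * t^-1)%g; rewrite actM.
Qed.

Lemma aa_flow_minimal X : aa_flow X -> minimal X.
Proof. by move=> [x [ax dx]]; exact: aa_dense_minimal ax dx. Qed.

(** If the fibre of a map to an equicontinuous flow at [x] is [x] alone, then
    convergence to [x] can be tested on images, where inverse translates are
    equicontinuous. *)
Lemma equicontinuous_fibre_aa X M (f : X -> M) (x : X) :
  equicontinuous_flow M -> flow_hom f -> f @^-1` [set f x] = [set x] ->
  aa_points x.
Proof.
move=> eM [cf ef] fx D t y txy U.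
rewrite nbhsE => -[W [oW Wx] WU].
have xfW : nbhs (f x) (~` (f @` (~` W))).
  apply: open_nbhs_nbhs; split.
    by rewrite openC; apply: flow_hom_closed => //; rewrite closedC.
  move=> [z Wz fzx]; apply: Wz.
  have : (f @^-1` [set f x]) z by [].
  by rewrite fx => ->.
have [E [cE tE]] := eM _ (compact_entourage_point xfW).
have : nbhs y [set z | E (f z, f y)].
  have /= cfy : (f z, f y) @[z --> y] --> ((f y, f y) : M * M).
    by apply: cvg_pair; [exact: cf|exact: cvg_cst].
  exact: cfy (cE (f y)).
move/txy => yE; have {}yE : tails D [set i | E (f (act (t i) x), f y)] := yE.
suff : tails D [set i | U (act (t i)^-1%g y)] by [].
apply: filterS yE => i /= /(tE (t i)^-1%g) /=.
rewrite -!ef actK => /(_ erefl) Wt; apply: WU; apply: contrapT => nW.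
by apply: Wt; exists (act (t i)^-1%g y).
Qed.

Lemma equicontinuous_aa M (x : M) : equicontinuous_flow M -> aa_points x.
Proof.
move=> eM; apply: (@equicontinuous_fibre_aa M M id x eM); last by apply/seteqP; split.
by split => // z; exact: cvg_id.
Qed.

Lemma minimal_equicontinuous_aa_flow M :
  minimal M -> equicontinuous_flow M -> aa_flow M.
Proof.
by move=> [[x _] mM] eM; exists x; split => //; exact: equicontinuous_aa.
Qed.

Lemma almost_one_one_aa_flow X M (f : X -> M) :
  equicontinuous_flow M -> almost_one_one f -> aa_flow X.
Proof.
move=> eM [[_ mX] _ [hf _] [x fx]]; exists x; split => //.
exact: equicontinuous_fibre_aa eM hf fx.
Qed.

Section return_times.
Variables (X : compactFlow G) (x : X).
Hypotheses (ax : aa_points x) (dx : dense (orbit x)).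

(** Along an ultrafilter on the indices, [gam n x] tends to some [y] and then
    [(gam m)^-1 y] tends to [x]; so the iterated limit of
    [(gam m)^-1 (gam n x)] is [x]. *)
Lemma aa_return_delta (gam : nat -> G) (U : set X) : nbhs x U ->
  exists m n, (m < n)%N /\ U (act ((gam m)^-1 * gam n)%g x).
Proof.
move=> xU; have [F [UF ooF]] := @ultraFilterLemma nat \oo _.
have [y Fy] := compact_ultra_cvg (fun n => act (gam n) x) UF.
have Fx : F [set m | U° (act (gam m)^-1%g y)].
  exact: (aa_filter _ ax Fy (nbhs_interior xU)).
have [m Um] := filter_ex Fx.
have Fn : F [set n | U (act (gam m)^-1%g (act (gam n) x))].
  exact: Fy _ (nbhs_act Um).
have Fm : F [set n | (m < n)%N] by apply: ooF; exact: nbhs_infty_gt.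
have [n [Un mn]] := filter_ex (filterI Fn Fm).
by exists m, n; split => //; rewrite actM.
Qed.

(** Let [C] be a closed neighbourhood of [x] inside [U].  If the claim fails,
    every neighbourhood [V] of [x] contains points [s x] and [t x] with
    [s^-1 t x] outside [C].  Choosing such pairs [s_n], [t_n] in shrinking neighbourhoods [V_n], the
    elements [gam n = t_0 t_1 ... t_(n-1) s_n] satisfy
    [(gam m)^-1 (gam n) = s_m^-1 t_m (t_(m+1) ... t_(n-1) s_n)], where the last
    factor moves [x] so little that [(gam m)^-1 (gam n) x] stays outside [C],
    against [aa_return_delta]. *)
Lemma aa_return_quotient (U : set X) : nbhs x U ->
  exists2 V : set X, nbhs x V &
    forall s t, V (act s x) -> V (act t x) -> U (act (s^-1 * t)%g x).
Proof.
move=> /nbhs_closed_nbhs [C [xC cC CU]]; apply: contrapT => noV.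
have bad (V : set X) : exists st : G * G, nbhs x V ->
    [/\ nbhs (act st.1 x) V, nbhs (act st.2 x) V & ~ C (act (st.1^-1 * st.2)%g x)].
  have [xV|xV] := pselect (nbhs x V); last by exists (1, 1)%g.
  apply: contrapT => nst; apply: noV; exists V°; first exact: nbhs_interior.
  move=> s t Vs Vt; apply: CU; apply: contrapT => nC.
  by apply: nst; exists (s, t) => _; split.
have {bad} [st stP] := choice bad.
pose step (V : set X) : set X := [set y | V (act (st V).2 y) /\
  ~ C (act ((st V).1^-1 * (st V).2)%g y)].
have xstep V : nbhs x V -> nbhs x (step V).
  move=> /stP [_ tV stC]; apply: filterI; first exact: nbhs_act.
  apply: (@nbhs_act _ _ _ _ (~` C)).
  by apply: open_nbhs_nbhs; split => //; rewrite openC.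
pose V n := iter n step setT.
have xV n : nbhs x (V n).
  by elim: n => [|n IH]; [exact: filterT|exact: xstep].
pose s n := (st (V n)).1; pose t n := (st (V n)).2.
pose P := fix P n := (if n is n'.+1 then P n' * t n' else 1)%g.
have PV m k y : V (m + k)%N y -> V m (act ((P m)^-1 * P (m + k)%N)%g y).
  elim: k y => [|k IH] y; first by rewrite addn0 mulVg act1.
  by rewrite addnS => -[Vt _]; rewrite /= mulgA actM; exact: IH.
have [m [n [mn Cmn]]] := aa_return_delta (fun n => P n * s n)%g xC.
move: Cmn; rewrite -(subnKC mn); set k := (n - m.+1)%N => Cmn.
have [/nbhs_singleton sV _ _] := stP _ (xV (m.+1 + k)%N).
have [_ stC] : step (V m) _ := PV m.+1 k _ sV.
apply: stC; rewrite -/(s _) -/(s _) -/(t _) -2!actM.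
suff -> : (((s m)^-1 * t m) * ((P m.+1)^-1 * P (m.+1 + k)%N) * s (m.+1 + k)%N =
  (P m * s m)^-1 * (P (m.+1 + k)%N * s (m.+1 + k)%N))%g by [].
by rewrite [P m.+1]/= !invgM !mulgA mulgK.
Qed.

(** The translates of a small neighbourhood [V] of [x] star-refine the
    translates of [U]: if a translate of [V] meets [V], it lies in [U].  By
    density this need only be checked for points of the orbit of [x], where it
    says that products [a b^-1 c] of return times to [V] are return times to
    [U]. *)
Lemma aa_star_refinement (U : set X) : nbhs x U ->
  exists2 V : set X, nbhs x V &
    forall g h y z, V (act g y) -> V (act h y) -> V (act h z) -> U (act g z).
Proof.
move=> /nbhs_closed_nbhs [C [xC cC CU]].
have [V1 xV1 V1C] := aa_return_quotient xC.
have [V2 xV2 V2V1] := aa_return_quotient xV1.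
have V2inv t : V2 (act t x) -> V1 (act t^-1%g x).
  move=> Vt; rewrite -[t^-1%g]mulg1; apply: V2V1 => //.
  by rewrite act1; exact: nbhs_singleton.
exists V2°; first exact: nbhs_interior.
move=> g h y z gy hy hz; apply: CU; apply: cC => W zW.
have [r [hr Wr]] := dense_orbit_nbhs dx (filterI (nbhs_act hz) (nbhs_act zW)).
have [t [gt ht]] := dense_orbit_nbhs dx (filterI (nbhs_act gy) (nbhs_act hy)).
exists (act (g * r)%g x); split; last by rewrite actM.
have -> : (g * r = ((g * t)^-1)^-1 * ((h * t)^-1 * (h * r)))%g.
  by rewrite invgK invgM !mulgA mulgK mulgVK.
by apply: V1C; [apply: V2inv|apply: V2V1]; rewrite actM.
Qed.

End return_times.
End aa_points_theory.

(** * Quotients by invariant uniformities *)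

Section invariant_quotient.
Variables (G : hltGroupType) (X : compactFlow G) (B : set_system (X * X)).

(** [B] is a basis of an invariant uniformity coarser than the topology; the
    quotient below is the Hausdorff quotient of [X] for it. *)
Hypotheses (BX : B setT)
  (BI : forall D E, B D -> B E -> exists2 F, B F & F `<=` D `&` E)
  (Bentourage : forall D, B D -> compact_entourage D)
  (Bsym : forall D p q, B D -> D (p, q) -> D (q, p))
  (Bact : forall D t p q, B D -> D (p, q) -> D (act t p, act t q))
  (Bcomp : forall D, B D -> exists2 E, B E &
     forall p q r, E (p, q) -> E (q, r) -> D (p, r)).

Let R : rel X := fun p q => `[< forall D, B D -> D (p, q) >].

Lemma inv_diag D p : B D -> D (p, p).
Proof. by move=> BD; exact: nbhs_singleton (Bentourage BD p). Qed.

Lemma inv_equiv : equiv_class_of R.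
Proof.
split.
- by move=> p; apply/asboolP => D; exact: inv_diag.
- by move=> p q; apply/asboolP/asboolP => pq D BD; apply: Bsym => //; exact: pq.
- move=> q p r /asboolP pq /asboolP qr; apply/asboolP => D BD.
  by have [E BE ED] := Bcomp BD; apply: ED (pq _ BE) (qr _ BE).
Qed.

Let Requiv : equiv_rel X := EquivRelPack inv_equiv.

Local Notation Q := (quotient_topology {eq_quot Requiv}%qT).

Definition inv_pi : X -> Q := (\pi_Q)%qT.

Lemma inv_piE p q : inv_pi p = inv_pi q <-> forall D, B D -> D (p, q).
Proof.
split => [/(@eqmodP _ Requiv) /asboolP //|pq].
by apply/(@eqmodP _ Requiv); apply/asboolP.
Qed.

Lemma inv_pi_surj (u : Q) : exists p, inv_pi p = u.
Proof. by exists (repr u); exact: reprK. Qed.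

Lemma inv_pi_continuous : continuous inv_pi.
Proof. exact: pi_continuous. Qed.


(** Writing [D p] for the points [D]-close to [p], the classes of the points [q]
    with [E q] inside [D p] for some [E] in [B] form an open set [O] of the
    quotient, as for the interior of [D p] in the topology of the uniformity. *)
Lemma inv_nbhs D p :
  B D -> nbhs (inv_pi p) [set u | exists2 q, u = inv_pi q & D (p, q)].
Proof.
move=> BD.
pose O : set Q := [set u | exists q E, [/\ u = inv_pi q, B E &
  forall r, E (q, r) -> D (p, r)]].
have oO : open O.
  suff : open (inv_pi @^-1` O) by [].
  rewrite openE => q [q' [E [qq' BE ED]]].
  have [F BF FE] := Bcomp BE; have [F' BF' F'F] := Bcomp BF.
  apply: filterS (compact_entourage_section q (Bentourage BF')) => r qr.
  exists r, F'; split => // s rs.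
  apply: ED; apply: FE (F'F _ _ _ qr rs).
  by apply: (inv_piE q' q).1 => //; exact: esym.
have Op : O (inv_pi p) by exists p, D; split.
apply: filterS (open_nbhs_nbhs (conj oO Op)) => _ [q [E [-> BE ED]]].
by exists q => //; apply: ED; exact: inv_diag.
Qed.

Lemma inv_hausdorff : hausdorff_space Q.
Proof.
move=> u v; have [p <-] := inv_pi_surj u; have [q <-] := inv_pi_surj v => pq.
apply/inv_piE => D BD.
have [E BE ED] := Bcomp BD; have [F BF FE] := Bcomp BE.
have [_ [[r -> pr] [s rs qs]]] := pq _ _ (inv_nbhs p BF) (inv_nbhs q BF).
apply: (ED p r q); first by apply: FE pr _; exact: inv_diag.
apply: (FE r s q); first by move/inv_piE: rs; exact.
exact: Bsym.
Qed.

Lemma inv_compact : compact [set: Q].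
Proof.
have -> : [set: Q] = inv_pi @` setT.
  by apply/seteqP; split => // u _; have [p <-] := inv_pi_surj u; exists p.
apply: continuous_compact; last exact: flow_compact.
by apply: continuous_subspaceT; exact: inv_pi_continuous.
Qed.

(** If no [D] in [B] works, the sets of pairs in [D] whose images are outside
    [E] have a cluster point in [X * X].  It lies in the closure of every
    member of [B], hence in every member, so it maps to the diagonal, of which
    [E] is a neighbourhood. *)
Lemma inv_entourage (E : set (Q * Q)) : (forall u, nbhs ((u, u) : Q * Q) E) ->
  exists2 D, B D & forall p q, D (p, q) -> E (inv_pi p, inv_pi q).
Proof.
move=> cE; apply: contrapT => noD.
pose F := filter_from B (fun D => [set r | D r /\ ~ E (inv_pi r.1, inv_pi r.2)]).
have FF : ProperFilter F.
  apply: filter_from_proper; last first.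
    move=> D BD; apply: contrapT => n0; apply: noD; exists D => // p q Dpq.
    by apply: contrapT => nE; apply: n0; exists (p, q).
  apply: filter_from_filter; first by exists setT.
  move=> D D' BD BD'; have [D'' BD'' sub] := BI BD BD'.
  by exists D'' => // r [/sub [Dr D'r] nE].
have cXX : compact [set: X * X].
  by rewrite -setXTT; apply: compact_setX; exact: flow_compact.
have [[p q] [_ pq]] := cXX F FF (@filterT _ F _).
have pqE : inv_pi p = inv_pi q.
  apply/inv_piE => D BD.
  have [D1 BD1 D1D] := Bcomp BD; have [D2 BD2 D2D1] := Bcomp BD1.
  have [] := pq [set r | D2 r] [set r | D2 (p, r.1) /\ D2 (q, r.2)].
  - by exists D2 => // r [].
  - exists ([set r | D2 (p, r)], [set r | D2 (q, r)]); last by move=> [r s] [].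
    by split; apply: compact_entourage_section; exact: Bentourage.
  - move=> [r s] [rs [/= pr qs]]; apply: (D1D p r q).
      by apply: D2D1 pr _; exact: inv_diag.
    by apply: D2D1 rs _; exact: Bsym.
have pqn : nbhs ((p, q) : X * X) [set r | E (inv_pi r.1, inv_pi r.2)].
  by apply: nbhs_pair_preimage inv_pi_continuous _; rewrite pqE; exact: cE.
have FnE : F [set r | ~ E (inv_pi r.1, inv_pi r.2)] by exists setT => // r [].
by have [r [nE rE]] := pq _ _ FnE pqn.
Qed.

Definition inv_act (t : G) (u : Q) : Q := inv_pi (act t (repr u)).

Lemma inv_act_pi t p : inv_act t (inv_pi p) = inv_pi (act t p).
Proof.
apply/inv_piE => D BD; apply: Bact => //.
by apply: (inv_piE _ _).1 => //; exact: reprK.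
Qed.

Lemma inv_act1 u : inv_act 1%g u = u.
Proof. by have [p <-] := inv_pi_surj u; rewrite inv_act_pi act1. Qed.

Lemma inv_actM s t u : inv_act (s * t)%g u = inv_act s (inv_act t u).
Proof. by have [p <-] := inv_pi_surj u; rewrite !inv_act_pi actM. Qed.

Lemma inv_act_continuous : continuous (fun p : G * Q => inv_act p.1 p.2).
Proof.
move=> [t u] U; have [p <-] := inv_pi_surj u; rewrite /= inv_act_pi => pU.
have [D BD DU] : exists2 D, B D & forall q, D (act t p, q) -> U (inv_pi q).
  pose E := [set v : Q * Q | v.1 = inv_pi (act t p) -> U v.2].
  have [|D BD DE] := @inv_entourage E; last by exists D => // q /DE; apply.
  move=> v; have [->|vp] := pselect (v = inv_pi (act t p)).
    by exists (setT, U) => [|[r s] [_ Us] _]; first by split => //; exact: filterT.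
  exists (~` [set inv_pi (act t p)], setT); last by move=> [r s] [rp _] /rp.
  split; last exact: filterT.
  apply: open_nbhs_nbhs; split => //; rewrite openC.
  exact: accessible_closed_set1 (hausdorff_accessible inv_hausdorff) _.
have [E BE ED] := Bcomp BD.
exists ([set s | E (act t p, act s p)], [set v | exists2 q, v = inv_pi q & E (p, q)]).
  split; last exact: inv_nbhs.
  exact: (@orbit_map_continuous G X p t _
    (compact_entourage_section (act t p) (Bentourage BE))).
move=> [s _] [/= tsp [q -> pq]]; rewrite inv_act_pi; apply: DU.
by apply: ED tsp _; exact: Bact.
Qed.

Lemma invariant_uniformity_quotient :
  exists (Y : compactFlow G) (pi : X -> Y),
    [/\ extension pi, equicontinuous_flow Y &
        forall p q, pi p = pi q <-> forall D, B D -> D (p, q)].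
Proof.
pose Y := CompactFlow inv_act1 inv_actM inv_act_continuous inv_compact inv_hausdorff.
exists Y, inv_pi; split; last exact: inv_piE.
  split; last exact: inv_pi_surj.
  by split => [|t p]; [exact: inv_pi_continuous|rewrite /= inv_act_pi].
move=> E cE; have [D BD DE] := inv_entourage cE.
exists [set v | exists p q, [/\ v = (inv_pi p, inv_pi q) & D (p, q)]]; split.
  move=> u; have [p <-] := inv_pi_surj u.
  have [D1 BD1 D1D] := Bcomp BD.
  pose N := [set v | exists2 q, v = inv_pi q & D1 (p, q)].
  exists (N, N); first by split; exact: inv_nbhs.
  move=> [_ _] [[/= q -> pq] [r -> pr]]; exists q, r; split => //.
  by apply: D1D pr; exact: Bsym.
move=> t _ [p [q [-> Dpq]]]; rewrite /= !inv_act_pi; apply: DE; exact: Bact.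
Qed.

End invariant_quotient.

(** * The equicontinuous factor of an almost automorphic flow *)

Section equicontinuous_factor.
Variable G : hltGroupType.
Implicit Types X Y M W : compactFlow G.

(** The relations [x, y in g^-1 U for some g], for [U] a neighbourhood of an
    a.a. point [x0], are invariant and form a basis of a uniformity by the
    star-refinement property.  The class of [x0] is trivial by the case [g = 1]
    of that property: a translate of [V] that contains [x0] meets [V].  If [x]
    and [y] are equivalent, some [g] moves both close to [x0]; then [f (g x)]
    and [f (g y)] are close, and remain so after the application of [g^-1] by
    equicontinuity. *)
Lemma aa_equicontinuous_factor X (x0 : X) : aa_points x0 -> dense (orbit x0) ->
  exists (Q : compactFlow G) (pi : X -> Q),
    [/\ extension pi, equicontinuous_flow Q,
        forall x, pi x = pi x0 -> x = x0 &
        forall M (f : X -> M), equicontinuous_flow M -> flow_hom f ->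
          forall x y, pi x = pi y -> f x = f y].
Proof.
move=> ax dx; have [_ mX] := aa_dense_minimal ax dx.
pose rl (U : set X) := [set p : X * X | exists g, U (act g p.1) /\ U (act g p.2)].
pose B := rl @` nbhs x0.
have [Q [pi [epi eQ piE]]] : exists (Y : compactFlow G) (pi : X -> Y),
    [/\ extension pi, equicontinuous_flow Y &
        forall p q, pi p = pi q <-> forall D, B D -> D (p, q)].
  apply: invariant_uniformity_quotient.
  - exists setT; first exact: filterT.
    by apply/seteqP; split => // -[p q] _; exists 1%g.
  - move=> _ _ [U xU <-] [V xV <-]; exists (rl (U `&` V)).
      by exists (U `&` V) => //; exact: filterI.
    by move=> [p q] [g [[Up Vp] [Uq Vq]]]; split; exists g.
  - move=> _ [U xU <-] p.
    have [g gU] := dense_orbit_nbhs (mX p) (nbhs_interior xU).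
    exists ([set q | U (act g q)], [set q | U (act g q)]).
      by split; exact: nbhs_act.
    by move=> [q r] [/= gq gr]; exists g.
  - by move=> _ p q [U _ <-] [g [gp gq]]; exists g.
  - move=> _ t p q [U _ <-] [g [gp gq]].
    by exists (g * t^-1)%g; rewrite /= !actM !actK.
  - move=> _ [U xU <-]; have [V xV VU] := aa_star_refinement ax dx xU.
    exists (rl V); first by exists V.
    move=> p q r [g [/= gp gq]] [h [/= hq hr]]; exists g.
    by split; [exact: (VU g g p p)|exact: (VU g h q r)].
exists Q, pi; split => //.
  move=> x /piE xx0; apply: (@flow_hausdorff G X) => A C xA xC.
  have [V xV VC] := aa_star_refinement ax dx xC.
  have [g [/= gx gx0]] := xx0 (rl V) (ex_intro2 _ _ V xV erefl).
  exists x; split; first exact: nbhs_singleton.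
  rewrite -[x]act1; apply: (VC _ g x0) => //.
  by rewrite act1; exact: nbhs_singleton.
move=> M f eM [cf ef] x y /piE xy; apply: contrapT => fxy.
have xN : nbhs (f x) [set m | m <> f y].
  apply: open_nbhs_nbhs; split => //.
  have := @accessible_closed_set1 M (hausdorff_accessible (@flow_hausdorff G M)) (f y).
  by rewrite -openC.
have [D [cD DE]] := eM _ (compact_entourage_point xN).
have [[A C] /= [xA xC] ACD] := cD (f x0).
have AC0 : nbhs x0 (f @^-1` (A `&` C)) by apply: filterI; exact: cf.
have [g [/= [gx _] [_ gy]]] := xy _ (ex_intro2 _ _ _ AC0 erefl).
have Dg : D (f (act g x), f (act g y)) by exact: ACD.
have := DE g^-1%g _ Dg.
by rewrite /= !ef !actK; apply.
Qed.

(** Let [O] be an invariant open entourage.  If [(phi^(i+1) y, phi^(j+1) y)] is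
    in [O], then so is [(phi^i (g y), phi^j (g y)) = g (phi^i y, phi^j y)] for
    some [g], since the orbit of [y] approaches [phi y]; hence so is
    [(phi^i y, phi^j y)].  As the sequence [phi^n y] has a cluster point, some
    [phi^n] with [n > 0] is thus [O]-close to the identity, and [phi] separates
    any two points that are not [O]-close to a common point. *)
Lemma equicontinuous_endomorphism_injective M (phi : M -> M) :
  minimal M -> equicontinuous_flow M -> flow_hom phi -> injective phi.
Proof.
move=> [[y _] mM] eM [cphi ephi] a b phiab.
apply: (@flow_hausdorff G M) => A B aA bB.
have [E [cE clE EAB]] := compact_entourage_closed
  (compact_entourageI (compact_entourage_point aA) (compact_entourage_point bB)).
have [D [cD DE]] := eM E cE.
pose O := [set p : M * M | exists g : G, nbhs ((act g p.1, act g p.2) : M * M) D].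
have OE p : O p -> E p.
  by move=> [g /nbhs_singleton /(DE g^-1%g)]; rewrite /= !actK; case: p.
have Oact g p q : O (act g p, act g q) -> O (p, q).
  by move=> [h hD]; exists (h * g)%g; rewrite /= !actM.
have Onbhs p q : O (p, q) -> nbhs ((p, q) : M * M) O.
  move=> [g /= gD].
  have := nbhs_pair_preimage (@act_continuous2 G M g) (nbhs_interior gD).
  by apply: filterS => r rD; exists g.
have cphin n : continuous (iter n phi).
  elim: n => [|n IH] x; first exact: cvg_id.
  by rewrite [iter _ _]/=; apply: continuous_comp; [exact: IH|exact: cphi].
have ephin n t x : iter n phi (act t x) = act t (iter n phi x).
  by elim: n => //= n ->; rewrite ephi.
have Opred i j : O (iter i.+1 phi y, iter j.+1 phi y) -> O (iter i phi y, iter j phi y).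
  rewrite !iterSr => /Onbhs [[U V] /= [iU jV] UVO].
  have [g [gU gV]] := dense_orbit_nbhs (mM y)
    (@filterI _ (nbhs (phi y)) _ _ _ (cphin i _ _ iU) (cphin j _ _ jV)).
  by apply: (Oact g); rewrite -!ephin; apply: UVO.
have [n On] : exists n, O (y, iter n.+1 phi y).
  have [z [_ zcl]] := @flow_compact G M ((fun n => iter n phi y) @ \oo) _ filterT.
  have [g gD] : exists g : G, nbhs ((act g z, act g z) : M * M) D by exists 1%g.
  have zO : nbhs ((z, z) : M * M) O by apply: Onbhs; exists g.
  case: zO => -[U V] /= [zU zV] UVO.
  have freq k : exists2 n, (k <= n)%N & (U `&` V) (iter n phi y).
    have [||_ [[n kn <-] UVn]] :=
      zcl [set iter n phi y | n in [set n | (k <= n)%N]] (U `&` V).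
    - by apply: filterS (nbhs_infty_ge k) => n kn; exists n.
    - exact: filterI.
    - by exists n.
  have [i _ [Ui _]] := freq 0%N; have [j ij [_ Vj]] := freq i.+1.
  exists (j - i.+1)%N; have : O (iter i phi y, iter j phi y) by exact: UVO.
  rewrite -{1}(subnKC ij) addSnnS; set k := (j - i.+1)%N.
  by elim: i {Ui ij} k => // i IH k /Opred; exact: IH.
have Eall x : E (x, iter n.+1 phi x).
  apply: clE => U [[V W] /= [xV xW] VWU].
  have [g [Vg Wg]] := dense_orbit_nbhs (mM y)
    (@filterI _ (nbhs x) _ _ _ xV (cphin n.+1 _ _ xW)).
  exists (act g y, act g (iter n.+1 phi y)); split.
    by apply: OE; apply: (Oact g^-1%g); rewrite !actK.
  by apply: VWU; split => //=; move: Wg; rewrite /= -/(iter n.+1 phi _) ephin.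
exists (iter n.+1 phi a); split; first by have [/(_ erefl)] := EAB _ (Eall a).
by have [_ /(_ erefl)] := EAB _ (Eall b); rewrite /= -!iterS !iterSr phiab.
Qed.

(** Let [pi] be the equicontinuous factor of [X].  The map [g f] induces an
    endomorphism of the range of [pi], which is injective; so the
    fibres of [f] lie in fibres of [pi], and one of these is a point. *)
Lemma hom_to_equicontinuous_factor_almost_one_one X (x0 : X) :
  aa_points x0 -> dense (orbit x0) ->
  exists Q : compactFlow G, [/\ minimal Q, equicontinuous_flow Q &
    forall W (f : X -> W), extension f -> (exists g : W -> Q, flow_hom g) ->
      almost_one_one f].
Proof.
move=> ax dx; have mX := aa_dense_minimal ax dx.
have [Q [pi [epi eQ pix0 piker]]] := aa_equicontinuous_factor ax dx.
have mQ := factor_minimal epi mX.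
exists Q; split => // W f ef [g hg].
have hgf : flow_hom (g \o f) by apply: flow_hom_comp hg; case: ef.
have [s hs spi] := flow_hom_factor epi hgf (piker _ _ eQ hgf).
split=> //; first exact: factor_minimal ef mX.
exists x0; apply/seteqP; split => [x fx|_ ->] //.
apply: pix0; apply: (equicontinuous_endomorphism_injective mQ eQ hs).
have sE z : s (pi z) = g (f z) by have /(congr1 (@^~ z)) := spi.
by rewrite !sE (fx : f x = f x0).
Qed.

Lemma universal_aa_almost_one_one X W (f : X -> W) :
  universal_aa_flow X -> extension f ->
  (forall Q : compactFlow G, minimal Q -> equicontinuous_flow Q -> factor Q W) ->
  almost_one_one f.
Proof.
move=> [[x0 [ax dx]] _] ef WQ.
have [Q [mQ eQ almost]] := hom_to_equicontinuous_factor_almost_one_one ax dx.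
by apply: almost => //; have [g [hg _]] := WQ Q mQ eQ; exists g.
Qed.

Lemma universal_aa_uniqueness X W :
  universal_aa_flow X -> universal_aa_flow W ->
  exists f : X -> W, almost_one_one f.
Proof.
move=> uX [aW uW]; have [f ef] := uX.2 W aW.
exists f; apply: universal_aa_almost_one_one => // Q mQ eQ.
by apply: uW; exact: minimal_equicontinuous_aa_flow.
Qed.

Lemma universal_aa_extension_Meq Meq X :
  universal_minimal_equicontinuous Meq -> universal_aa_flow X ->
  exists f : X -> Meq, almost_one_one f.
Proof.
move=> [mM eM uM] uX.
have [f ef] := uX.2 Meq (minimal_equicontinuous_aa_flow mM eM).
by exists f; exact: universal_aa_almost_one_one.
Qed.

Lemma universal_aa_maximal Meq X : universal_minimal_equicontinuous Meq ->
  universal_aa_flow X -> maximal_almost_one_one Meq X.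
Proof.
move=> uM uX; split; first exact: universal_aa_extension_Meq.
move=> Y [f af]; apply: uX.2; have [_ eM _] := uM.
exact: almost_one_one_aa_flow eM af.
Qed.

(** A universal a.a. flow [U] is itself an almost one-to-one extension of [Meq],
    so it is a factor of any maximal one. *)
Lemma maximal_universal_aa Meq X (U : compactFlow G) :
  universal_minimal_equicontinuous Meq -> universal_aa_flow U -> maximal_almost_one_one Meq X -> universal_aa_flow X.
Proof.
move=> uM uU [[f af] maxX]; split.
  by have [_ eM _] := uM; exact: almost_one_one_aa_flow eM af.
move=> Y aY; have [g eg] := uU.2 Y aY.
have [h eh] := maxX U (universal_aa_extension_Meq uM uU).
by exists (g \o h); exact: extension_comp.
Qed.

End equicontinuous_factor.

(** * The canonical flow *)

Section orbit_extension.
Variable G : hltGroupType.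

(** The map [t x0 |-> t y0] extends by continuity because it has a limit at
    every point and [Y] is regular. *)
Lemma orbit_map_extends (X Y : compactFlow G) (x0 : X) (y0 : Y) :
  dense (orbit x0) ->
  (forall x : X, exists y : Y, forall W, nbhs y W ->
    exists2 U, nbhs x U & forall t, U (act t x0) -> W (act t y0)) ->
  exists2 phi : X -> Y, flow_hom phi & phi x0 = y0.
Proof.
move=> dx /choice [phi phiP]; exists phi; last first.
  apply: (@flow_hausdorff G Y) => A B /phiP [U xU UA] yB.
  exists y0; split; last exact: nbhs_singleton.
  by rewrite -[y0]act1; apply: UA; rewrite act1; exact: nbhs_singleton.
split => [x W /nbhs_closed_nbhs [C [xC cC CW]]|s x].
  have [U xU UC] := phiP x C xC.
  suff : nbhs x [set z | W (phi z)] by [].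
  apply: filterS (nbhs_interior xU) => z Uz; apply/CW/cC => W' /phiP [U' zU' U'W'].
  have [t [Ut U't]] := dense_orbit_nbhs dx (filterI Uz zU').
  by exists (act t y0); split; [exact: UC|exact: U'W'].
apply: (@flow_hausdorff G Y) => A B /phiP [U xU UA] /nbhs_act /phiP [U' xU' U'B].
have [t [Ut U't]] := dense_orbit_nbhs dx (filterI (nbhs_act xU) xU').
exists (act s (act t y0)); split; last exact: U'B.
by rewrite -actM; apply: UA; rewrite actM.
Qed.

End orbit_extension.

Lemma not_tails_subnet (D : directedSet) (P : set D) : ~ tails D P ->
  exists (E : directedSet) (h : E -> D),
    subnet_index h /\ tails E [set i | ~ P (h i)].
Proof.
move=> nP; pose F := within (~` P) (tails D).
have FF : ProperFilter F.
  apply: Build_ProperFilter => F0.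
  have {}F0 : tails D [set i | ~ ~ P i] := F0.
  by apply: nP; apply: filterS F0 => i; exact: contrapT.
exists (filter_dir FF), (@filter_net _ _ FF); split.
  rewrite /subnet_index filter_netE; exact: cvg_within.
suff : (@filter_net _ _ FF @ tails (filter_dir FF)) (~` P) by [].
by rewrite filter_netE; apply: (filterS _ (filterT : tails D setT)) => i _.
Qed.

Section canonical_flow_theory.
Variables (R : realType) (G : hltGroupType).
Local Notation V := (@Vaa R G).
Local Notation Ma := (Ma R G).

Lemma Ma_base_proof : @point_eval R G 1%g \in @Ma_set R G.
Proof. by apply/mem_set/subset_closure; exists 1%g. Qed.

Definition Ma_base : Ma := exist _ (@point_eval R G 1%g) Ma_base_proof.

Definition Ma_eval (mu : Ma) (f : V) : CC R := val (val mu) f.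

Lemma Ma_eval_orbit t f : Ma_eval (act t Ma_base) f = val f t.
Proof. by rewrite /Ma_eval /= /ltrans mulg1. Qed.

Lemma Ma_base_dense : dense (orbit Ma_base).
Proof.
apply: dense_orbitP => mu U /nbhs_set_type [W muW WU].
have [_ [[t _ <-] Wt]] := set_mem (valP mu) W muW.
exists t; apply: WU; congr W: Wt; apply: val_inj; apply/funext => f.
by rewrite -[LHS]Ma_eval_orbit.
Qed.

Lemma Ma_cvg (S : Type) (F : set_system S) (m : S -> Ma) (mu : Ma) :
  Filter F -> (forall f, Ma_eval (m s) f @[s --> F] --> Ma_eval mu f) ->
  m @ F --> mu.
Proof.
move=> FF mf U /nbhs_set_type [W muW WU].
have {}muW : nbhs (val mu) W := muW.
have [W' muW' W'W] := nbhs_set_type muW.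
have : (fun s => val (val (m s)) : {ptws V -> CC R}) @ F --> val (val mu).
  by apply: ptws_cvg => f; exact: mf.
move=> /(_ W' muW') FW'; have {}FW' : F [set s | W' (val (val (m s)))] := FW'.
by apply: (filterS _ FW') => s /W'W; exact: WU.
Qed.

Lemma Ma_orbit_cvg (S : Type) (F : set_system S) {FF : Filter F} (t : S -> G)
    (mu : Ma) (f : V) :
  act (t s) Ma_base @[s --> F] --> mu ->
  val f (t s) @[s --> F] --> Ma_eval mu f.
Proof.
move=> tmu.
have -> : (fun s => val f (t s)) = (fun s => Ma_eval (act (t s) Ma_base) f).
  by apply/funext => s; rewrite Ma_eval_orbit.
apply: (@cvg_comp _ _ _ (fun s => act (t s) Ma_base) (Ma_eval^~ f) _ (nbhs mu)) => //.
exact: Ma_eval_continuous.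
Qed.

(** Write [e] for [Ma_base].  If [t_i e -> mu], then [f (x t_i) -> phi x] with
    [phi x = mu (f x)] for every [f] in [V], and [t_i^-1 mu] maps [f] to [phi (t_i^-1)].  Every subnet
    has a subnet along which [phi (t_i^-1) -> f 1], by left almost
    automorphy of [f]; hence the whole net converges to [f 1]. *)
Lemma Ma_base_aa : aa_points Ma_base.
Proof.
move=> D t mu tmu; apply: Ma_cvg => f.
pose phi x := Ma_eval mu (Vaa_translate f x).
have fphi x : rtrans (t i) (val f) x @[i --> tails D] --> phi x.
  exact: (Ma_orbit_cvg (f := Vaa_translate f x) tmu).
have -> : Ma_eval Ma_base f = val f 1%g by [].
move=> W fW; suff : tails D [set i | W (phi (t i)^-1%g)] by [].
apply: contrapT => /not_tails_subnet [E [h [hsub nW]]].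
have [faa _] := set_mem (valP f).
have [E' [h' [phi' [h'sub _ fphi' phi'f]]]] := faa E (t \o h).
have phiE x : phi' x = phi x.
  apply: (cvg_unique (@norm_hausdorff _ (CC R)) (fphi' x)).
  have hh' : (h \o h') @ tails E' --> tails D by apply: cvg_comp h'sub hsub.
  exact: cvg_comp hh' (fphi x).
have W1 : tails E' [set i | W (phi (t (h (h' i)))^-1%g)].
  have {}fW : tails E' [set i | W (phi' (1 * (t (h (h' i)))^-1)%g)] := phi'f 1%g W fW.
  by apply: filterS fW => i; rewrite /= mul1g phiE.
have W2 : tails E' [set i | ~ W (phi (t (h (h' i)))^-1%g)] := h'sub _ nW.
by have [i [Wi nWi]] := filter_ex (filterI W1 W2).
Qed.

Lemma Ma_aa_flow : aa_flow Ma.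
Proof. by exists Ma_base; split; [exact: Ma_base_aa|exact: Ma_base_dense]. Qed.

Lemma Ma_minimal : minimal Ma.
Proof. exact: aa_flow_minimal Ma_aa_flow. Qed.

Section coefficients.
Variables (Y : compactFlow G) (F : Y -> CC R).
Hypothesis (cF : continuous F).

(** By compactness of [Y], joint continuity of the action is uniform in [y]; this
    gives the left uniform continuity of coefficients. *)
Lemma act_uniform (t0 : G) (e : CC R) : (0 < e)%R ->
  \forall t \near t0, forall y, (`|F (act t y) - F (act t0 y)| < e)%R.
Proof.
move=> e0.
have near_y (y : Y) : \forall z \near y & t \near nbhs t0,
    (`|F (act t z) - F (act t0 z)| < e)%R.
  pose D (p : Y * G) : CC R := (F (act p.2 p.1) - F (act t0 p.1))%R.
  suff /cvgrPdist_lt/(_ e e0) : D p @[p --> ((y, t0) : Y * G)] --> (0 : CC R)%R.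
    by apply: filterS => -[z t]; rewrite sub0r normrN.
  rewrite -[X in _ --> X](subrr (F (act t0 y))).
  apply: cvgB; (apply: cvg_comp; last exact: cF).
    by apply: act_cvg; [exact: cvg_snd|exact: cvg_fst].
  by apply: act_cvg; [exact: cvg_cst|exact: cvg_fst].
have := (compact_near_coveringP [set: Y]).1 (@flow_compact G Y) G (nbhs t0)
  (fun t y => (`|F (act t y) - F (act t0 y)| < e)%R) (nbhs_filter t0)
  (fun y _ => near_y y).
by apply: filterS => t tY y; exact: tY.
Qed.

(** Along a subnet with [t_i y0 -> y], the translates of the coefficient converge
    to the coefficient of [y], and back because [y0] is a.a. *)
Lemma coefficient_aa (y0 : Y) : aa_points y0 ->
  left_almost_automorphic (fun t => F (act t y0)).
Proof.
move=> ay D t.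
have [U [UU DU]] := @ultraFilterLemma _ (tails D) _.
have [y ty] := compact_ultra_cvg (fun i => act (t i) y0) UU.
have UP : ProperFilter U by exact: ultra_proper.
exists (filter_dir UP), (@filter_net _ _ UP), (fun x => F (act x y)).
have cvgF (z : D -> Y) (l : Y) x : z i @[i --> U] --> l ->
    F (act x (z (filter_net i))) @[i --> tails (filter_dir UP)] --> F (act x l).
  move=> zl; apply: (@cvg_comp _ _ _ (fun i => z (filter_net i))
    (fun y => F (act x y)) _ (nbhs l)).
    have : (z \o @filter_net _ _ UP) @ tails (filter_dir UP) --> l.
      by rewrite -[X in X --> _]/(z @ (@filter_net _ _ UP @ tails _)) filter_netE.
    exact.
  by apply: continuous_comp; [exact: act_continuous2|exact: cF].
split.
- by rewrite /subnet_index filter_netE.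
- by move=> x; apply: continuous_comp; [exact: orbit_map_continuous|exact: cF].
- move=> x; rewrite /rtrans; under eq_fun do rewrite actM.
  exact: (cvgF (fun i => act (t i) y0)).
- move=> x; rewrite /rtrans; under eq_fun do rewrite actM.
  exact: (cvgF (fun i => act (t i)^-1%g y) _ _ (aa_filter UP ay ty)).
Qed.

Lemma coefficient_Vaa (y0 : Y) (M : CC R) : aa_points y0 ->
  (forall y, `|F y| <= M)%R -> V (fun t => F (act t y0)).
Proof.
move=> ay FM; split; first exact: coefficient_aa.
split.
- by exists M => t; exact: FM.
- by move=> x; apply: continuous_comp; [exact: orbit_map_continuous|exact: cF].
- move=> D t t0 tt0 e e0; have ti := tt0 _ (act_uniform t0 e0).
  have {}ti : tails D [set i | forall y,
    (`|F (act (t i) y) - F (act t0 y)| < e)%R] := ti.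
  apply: filterS ti => i ti x; rewrite /ltrans !actM; exact: ti.
Qed.

End coefficients.

Lemma flow_functions_separate (Y : compactFlow G) (y z : Y) : y <> z ->
  exists F : Y -> CC R, [/\ continuous F, (forall x, `|F x| <= 1)%R & F y <> F z].
Proof.
move=> yz.
have cl1 (x : Y) : closed [set x].
  exact: accessible_closed_set1 (hausdorff_accessible (@flow_hausdorff G Y)) _.
have yz0 : [set y] `&` [set z] = set0.
  by apply/seteqP; split => // x [/= -> /yz].
have nY := compact_normal (@flow_hausdorff G Y) (@flow_compact G Y).
have := (@normal_separatorP R Y).1 nY _ _ (cl1 y) (cl1 z) yz0.
move=> /(@uniform_separatorP _ R) [g [cg g01 gy gz]].
exists (fun x => (g x)%:C%C); split.
- by move=> x; apply: continuous_comp; [exact: cg|exact: real_complex_continuous].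
- move=> x; have /g01 /= : range g (g x) by exists x.
  rewrite in_itv /= => /andP[g0 g1].
  by rewrite normc_def /= expr0n /= addr0 sqrtr_sqr lecR ger0_norm.
- have -> : g y = 0%R by apply: gy; exists y.
  have -> : g z = 1%R by apply: gz; exists z.
  by move=> [] /eqP; rewrite eq_sym oner_eq0.
Qed.

(** A point [mu] of [Ma] is the limit of [t Ma_base] along a filter of [t] in [G].
    Along it, [t y0] has only one cluster point [y]: the coefficients
    [F (t y0)] lie in [V], hence converge to their values at [mu], and functions [F] separate
    the points of [Y]. *)
Lemma Ma_factor (Y : compactFlow G) : aa_flow Y -> factor Y Ma.
Proof.
move=> [y0 [ay dy]].
have [mu|phi hphi phie] :=
  orbit_map_extends Ma_base_dense (x0 := Ma_base) (y0 := y0); last first.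
  by exists phi; apply: (@flow_hom_surj _ _ _ _ Ma_base) => //; rewrite phie.
pose F := filter_from (nbhs mu) (fun U => [set t : G | U (act t Ma_base)]).
have FF : ProperFilter F.
  apply: filter_from_proper; last first.
    by move=> U /(dense_orbit_nbhs Ma_base_dense) [t Ut]; exists t.
  apply: filter_from_filter; first by exists setT; exact: filterT.
  by move=> A B muA muB; exists (A `&` B) => //; exact: filterI.
have Fmu : act t Ma_base @[t --> F] --> mu by move=> U muU; exists U.
have clusterE (H : Y -> CC R) : continuous H -> (forall y, `|H y| <= 1)%R ->
    exists l, forall y, cluster (act t y0 @[t --> F]) y -> H y = l.
  move=> cH H1; pose f : V :=
    exist (fun f => f \in V) _ (mem_set (coefficient_Vaa cH ay H1)).
  exists (Ma_eval mu f) => y yF; apply: (@norm_hausdorff _ (CC R)) => A B HA lB.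
  have FB : F [set t | B (H (act t y0))].
    exact: (Ma_orbit_cvg (f := f) Fmu lB).
  have [] := yF [set z | B (H z)] [set z | A (H z)].
  - exact: FB.
  - exact: cH HA.
  - by move=> z [Bz Az]; exists (H z).
have [y [_ yF]] := @flow_compact G Y (act t y0 @[t --> F]) _ (@filterT _ F _).
exists y => W yW.
have : act t y0 @[t --> F] --> y.
  apply: (compact_cluster_set1 (@flow_hausdorff G Y) (@flow_compact G Y)).
  - exact: filterT.
  - exact: filterT.
  - apply/seteqP; split => [z zF|_ -> //]; apply: contrapT => zy.
    have [H [cH H1]] := flow_functions_separate zy; apply.
    by have [l Hl] := clusterE H cH H1; rewrite !Hl.
by move=> /(_ W yW) [U muU UW]; exists U.
Qed.

End canonical_flow_theory.

(** Evaluation at [b] composed with [eta \o phi] is an endomorphism of [Ma]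
    which fixes [a], hence all points; so [phi] is injective. *)
Lemma Ma_endomorphism_automorphism (R : realType) (G : hltGroupType)
    (phi : Ma R G -> Ma R G) (a : Ma_aa R G) (eta : Ma R G -> Zflow R G) :
  endomorphism phi -> flow_hom eta -> range (Zmap (eta (phi (val a)))) (val a) ->
  automorphism phi.
Proof.
move=> hphi heta [b _ ba]; split => //.
have mMa := Ma_minimal R G.
pose ev (xi : Zflow R G) : Ma R G := Zmap xi b.
have hev : flow_hom ev.
  split => // xi.
  apply: (@cvg_comp _ _ _ (fun xi : Zflow R G => val xi)
    (fun p : Ma_power R G => p b) _ (nbhs (val xi))).
    exact: set_type_continuous.
  have evb := @ptws_eval_continuous (Ma_aa R G) (Ma R G) b (val xi).
  exact: evb.
have hid : flow_hom (id : Ma R G -> Ma R G) by split => // x; exact: cvg_id.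
have idE : ev \o eta \o phi =1 id.
  have hfix := flow_hom_comp hphi (flow_hom_comp heta hev).
  exact: flow_hom_eq hfix hid (mMa.2 (val a)) ba.
have [_ surj] := minimal_hom_extension mMa mMa hphi.
exists (ev \o eta) => x; first exact: idE.
by have [y <-] := surj x; congr phi; exact: idE.
Qed.

Theorem theorem6p2 (R : realType) (G : hltGroupType) :
  [/\ universal_aa_flow (Ma R G),
      forall Meq : compactFlow G, universal_minimal_equicontinuous Meq ->
        forall Y : compactFlow G,
          universal_aa_flow Y <-> maximal_almost_one_one Meq Y,
      forall phi : Ma R G -> Ma R G, endomorphism phi ->
        (exists (a : Ma_aa R G) (eta : Ma R G -> Zflow R G),
           flow_hom eta /\ range (Zmap (eta (phi (val a)))) (val a)) ->
        automorphism phi &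
      forall X1 X2 : compactFlow G,
        universal_aa_flow X1 -> universal_aa_flow X2 ->
        exists phi : X1 -> X2, almost_one_one phi].
Proof.
have uMa : universal_aa_flow (Ma R G).
  by split=> [|Y aY]; [exact: Ma_aa_flow|exact: Ma_factor].
split => //.
- move=> Meq uM Y; split; first exact: universal_aa_maximal.
  exact: maximal_universal_aa uM uMa.
- move=> phi hphi [a [eta [heta eta_a]]].
  exact: Ma_endomorphism_automorphism hphi heta eta_a.
- exact: universal_aa_uniqueness.
Qed.
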